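(* Let $G$ be a finite group. If $\delta_{\mathcal{CD}}(G) < 5$, then $G$ is nilpotent.
   Context: For a finite group $G$ and a subgroup $H\leq G$, the Chermak--Delgado measure of $H$ is $m_G(H)=|H|\cdot|\mathbf{C}_G(H)|$, where $\mathbf{C}_G(H)$ is the centralizer of $H$ in $G$. Let $m^*(G)=\max_{H\leq G} m_G(H)$. The Chermak--Delgado lattice of $G$ is $\mathcal{CD}(G)=\{H\leq G : m_G(H)=m^*(G)\}$. Write $\delta_{\mathcal{CD}}(G)$ for the number of subgroups of $G$ that are not in $\mathcal{CD}(G)$. *)

(* Defs.v *)
From HB Require Import structures.
From mathcomp Require Import all_boot all_fingroup all_solvable.

Set Implicit Arguments.
Unset Strict Implicit.
Unset Printing Implicit Defensive.

Local Open Scope group_scope.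

Definition cd_measure (gT : finGroupType) (G H : {group gT}) : nat :=
  #|H| * #|'C_G(H)|.

Definition cd_max (gT : finGroupType) (G : {group gT}) : nat :=
  \max_(H in subgroups G) cd_measure G H.

Definition cd_lattice (gT : finGroupType) (G : {group gT}) :
    {set {group gT}} :=
  [set H in subgroups G | cd_measure G H == cd_max G].

Definition cd_delta (gT : finGroupType) (G : {group gT}) : nat :=
  #|subgroups G :\: cd_lattice G|.

(* Main.v *)
(**
For subgroups [H], [K] one has [m(H) m(K) <= m(<H,K>) m(H :&: K)], so two
members of the Chermak-Delgado lattice permute. If [P <= H <= N_G(P)] for a
non-normal Sylow subgroup [P], then [H] does not permute with some conjugate,
so [H] is outside the lattice. Hence the [n = n_p(G) >= p + 1] conjugates of
[P] are all outside, and so are those of [N_G(P)]. With fewer than five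
subgroups outside, [N_G(P) = P] and [(p, n)] is [(2, 3)] or [(3, 4)], so
[|G| = n |P|] and [G] has an abelian Sylow subgroup [T] of order [n]. The
subgroups [1], [T] and [G] then provide the missing subgroups outside the
lattice, by comparing their measures.
*)
Require Import Defs.
From mathcomp Require Import all_boot all_fingroup all_solvable.

Set Implicit Arguments.
Unset Strict Implicit.
Unset Printing Implicit Defensive.

Local Open Scope group_scope.

(** A normal Sylow subgroup is nilpotent, so it lies in ['F(G)]; hence every prime part of [#|G|]
    divides [#|'F(G)|]. *)
Lemma Sylow_normal_nilpotent (gT : finGroupType) (G : {group gT}) :
  (forall (p : nat) (P : {group gT}), prime p -> p.-Sylow(G) P -> P <| G) ->
  nilpotent G.
Proof.
move=> nsSyl; suff <- : 'F(G) = G by exact: Fitting_nil.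
apply/eqP; rewrite eqEcard Fitting_sub dvdn_leq //.
apply/dvdn_partP=> // p; rewrite mem_primes => /and3P[p_pr _ _].
have [P sylP] := Sylow_exists p G.
rewrite -(card_Hall sylP) cardSg // Fitting_max ?(nsSyl p) //.
exact: pgroup_nil (pHall_pgroup sylP).
Qed.

Lemma Sylow_normal_conj (gT : finGroupType) (G P Q : {group gT}) p :
  p.-Sylow(G) P -> p.-Sylow(G) Q -> P <| G -> Q <| G.
Proof.
move=> sylP sylQ nsP; have [x Gx ->] := Sylow_trans sylP sylQ.
by rewrite /= (normsP (normal_norm nsP)).
Qed.

(** * Permutability of the members of the lattice *)

Section ChermakDelgado.

Variables (gT : finGroupType) (G : {group gT}).
Implicit Types H K P Q R T : {group gT}.

Lemma cd_latticeP H :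
  reflect (H \subset G /\ cd_measure G H = cd_max G) (H \in cd_lattice G).
Proof. by rewrite !inE; apply: (iffP andP) => -[-> /eqP]. Qed.

Lemma cd_measure_le_max H : H \subset G -> cd_measure G H <= cd_max G.
Proof. by move=> sHG; apply: leq_bigmax_cond; rewrite inE. Qed.

Lemma cd_max_gt0 : 0 < cd_max G.
Proof.
apply: leq_trans (cd_measure_le_max (subxx G)).
by rewrite muln_gt0 !cardG_gt0.
Qed.

Lemma cd_measureJ H x : x \in G -> cd_measure G (H :^ x)%G = cd_measure G H.
Proof.
move=> Gx; rewrite /cd_measure cardJg /= -{1}(conjGid Gx) centJ -conjIg.
by rewrite cardJg.
Qed.

Lemma cd_latticeJ H x :
  x \in G -> H \in cd_lattice G -> (H :^ x)%G \in cd_lattice G.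
Proof.
move=> Gx /cd_latticeP[sHG mH]; apply/cd_latticeP; split.
  by rewrite -(conjGid Gx) conjSg.
by rewrite cd_measureJ.
Qed.

(** The product formula, for [H], [K] and for their centralisers, splits [m(H) m(K)] into
    [#|H * K| * #|CH :&: CK|] and [#|H :&: K| * #|CH * CK|]. Since [CH * CK] centralises [H :&: K],
    the second factor is at most [cd_max G], so the first is at least [cd_max G], which bounds
    [m(H <*> K)]. This leaves no room for [H <*> K] to exceed [H * K]. *)
Lemma cd_lattice_commute H K :
  H \in cd_lattice G -> K \in cd_lattice G -> commute H K.
Proof.
move=> /cd_latticeP[sHG mH] /cd_latticeP[sKG mK].
set CH := 'C_G(H)%G; set CK := 'C_G(K)%G.
have mJ : #|H <*> K| * #|CH :&: CK| <= cd_max G.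
  rewrite -(_ : 'C_G(H <*> K) = CH :&: CK).
    by apply: (cd_measure_le_max (H := (H <*> K)%G)); rewrite join_subG sHG.
  by rewrite centY setIIr.
have mI : #|H :&: K| * #|CH * CK| <= cd_max G.
  apply: leq_trans (cd_measure_le_max (H := (H :&: K)%G) _); last first.
    exact: subset_trans (subsetIl _ _) sHG.
  rewrite leq_mul2l subset_leq_card ?orbT // mul_subG ?setIS ?centS //.
    exact: subsetIl.
  exact: subsetIr.
have eqm : (#|(H * K)%g| * #|CH :&: CK| * (#|H :&: K| * #|(CH * CK)%g|)
            = cd_max G * cd_max G)%N.
  rewrite -{1}mH -mK /cd_measure -/CH -/CK.
  rewrite [RHS]mulnACA (mul_cardG H K) (mul_cardG CH CK).
  by rewrite [(#|(CH * CK)%g| * _)%N]mulnC [RHS]mulnACA.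
have sHK : H * K \subset H <*> K by rewrite mul_subG ?joing_subl ?joing_subr.
suff /eqP eqHK : H * K == H <*> K by apply/comm_group_setP; rewrite eqHK groupP.
rewrite eqEcard sHK /= -(leq_pmul2r (cardG_gt0 (CH :&: CK)%G)).
apply: leq_trans mJ _.
by rewrite -(leq_pmul2r cd_max_gt0) -eqm leq_mul2l mI orbT.
Qed.

(* If [H] and [H :^ x] permute, then [P] and [P :^ x] are Sylow subgroups of
   the group [H * H :^ x]; they are conjugate by some [h * k] with [h]
   normalising [P] and [k] normalising [P :^ x], hence equal. *)
Lemma cd_lattice_Sylow_normal p P H :
    p.-Sylow(G) P -> P \subset H -> H \subset 'N_G(P) ->
  H \in cd_lattice G -> P <| G.
Proof.
move=> sylP sPH; rewrite subsetI => /andP[sHG nPH] CDH.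
apply/andP; split; first exact: pHall_sub sylP.
apply/subsetP=> x Gx; rewrite inE.
have cHHx := cd_lattice_commute CDH (cd_latticeJ Gx CDH).
pose J := (H <*> H :^ x)%G.
have eqJ : J = H * H :^ x :> {set gT} := comm_joingE cHHx.
have sJG : J \subset G.
  by rewrite join_subG sHG -{1}(conjGid Gx) conjSg.
have sylPJ : p.-Sylow(J) P.
  by apply: pHall_subl sJG sylP; rewrite (subset_trans sPH) ?joing_subl.
have sylPx : p.-Sylow(J) (P :^ x)%G.
  apply: pHall_subl sJG _; last by rewrite pHallJ.
  by rewrite (subset_trans _ (joing_subr _ _)) //= conjSg.
have [y Jy /= eqPx] := Sylow_trans sylPJ sylPx.
move: Jy; rewrite eqJ => /mulsgP[h k Hh Hk def_y].
have nPh : P :^ h = P by exact: normP (subsetP nPH h Hh).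
have nPxk : (P :^ x) :^ k = P :^ x.
  by apply: normP; rewrite normJ; apply: subsetP Hk; rewrite conjSg.
move: eqPx; rewrite def_y conjsgM nPh -{1}nPxk => /conjsg_inj ->.
exact: subxx.
Qed.

(** * Subgroups outside the lattice *)

Definition cd_bad : {set {group gT}} := subgroups G :\: cd_lattice G.

Lemma cd_badE H : (H \in cd_bad) = (H \subset G) && (H \notin cd_lattice G).
Proof. by rewrite /cd_bad in_setD andbC [H \in subgroups G]inE. Qed.

Lemma Syl_sub_cd_bad p P :
  p.-Sylow(G) P -> ~~ (P <| G) -> 'Syl_p(G) \subset cd_bad.
Proof.
move=> sylP nnP; apply/subsetP=> Q; rewrite inE => sylQ.
have sQG := pHall_sub sylQ; rewrite cd_badE sQG; apply: contra nnP => CDQ.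
apply: (Sylow_normal_conj sylQ sylP _).
apply: (cd_lattice_Sylow_normal sylQ (subxx _) _ CDQ).
by rewrite subsetI sQG normG.
Qed.

(** The Sylow subgroups and their normalisers form two disjoint families of equal size: [Q] is the
    only Sylow [p]-subgroup of ['N_G(Q)], and a normaliser that is itself Sylow equals [Q], which by
    conjugacy would make [P] self-normalising. *)
Lemma card_cd_bad_norm p P :
    p.-Sylow(G) P -> ~~ (P <| G) -> 'N_G(P) != P ->
  #|'Syl_p(G)| * 2 <= #|cd_bad|.
Proof.
move=> sylP nnP neqN.
pose N (Q : {group gT}) := 'N_G(Q)%G.
have sylN Q : p.-Sylow(G) Q -> p.-Sylow(N Q) Q by rewrite Sylow_subnorm.
have injN : {in 'Syl_p(G) &, injective N}.
  move=> Q R; rewrite !inE => sylQ sylR eqN.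
  have sylRN : p.-Sylow(N Q) R by rewrite eqN; exact: sylN.
  have [x /setIP[_ nQx] eqR] := Sylow_trans (sylN _ sylQ) sylRN.
  by apply: val_inj; rewrite /= eqR (normP nQx).
have badN : N @: 'Syl_p(G) \subset cd_bad.
  apply/subsetP=> _ /imsetP[Q SQ ->]; move: SQ; rewrite inE => sylQ.
  rewrite cd_badE subsetIl; apply: contra nnP => CDN.
  apply: (Sylow_normal_conj sylQ sylP _).
  apply: (cd_lattice_Sylow_normal sylQ _ (subxx _) CDN).
  by rewrite subsetI normG (pHall_sub sylQ).
have tiN : [disjoint 'Syl_p(G) & N @: 'Syl_p(G)].
  apply/pred0P=> R /=; apply: contraNF neqN => /andP[].
  rewrite inE => sylR /imsetP[Q]; rewrite inE => sylQ eqR.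
  have eqRQ : R = Q :> {set gT}.
    apply: (sub_pHall sylQ (pHall_pgroup sylR) _ (pHall_sub sylR)).
    by rewrite eqR subsetI normG (pHall_sub sylQ).
  have nQ : 'N_G(Q) = Q by rewrite -[RHS]eqRQ eqR.
  have [x Gx ->] := Sylow_trans sylQ sylP.
  by rewrite /= normJ -{1}(conjGid Gx) -conjIg nQ.
rewrite muln2 -addnn -{2}(card_in_imset injN).
rewrite -cardsUI (disjoint_setI0 tiN) cards0 addn0 subset_leq_card //.
by rewrite subUset badN (Syl_sub_cd_bad sylP).
Qed.

(** Otherwise [m(T) = m(1) = #|G|] gives [#|'C_G(T)| = m]; but [T] lies in its centraliser, so [n]
    would divide [m]. *)
Lemma abelian_Hall_cd_bad T (n m : nat) :
    T \subset G -> abelian T -> #|T| = n -> 1 < n ->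
    #|G| = (n * m)%N -> coprime n m ->
  1%G \in cd_lattice G -> T \in cd_bad.
Proof.
move=> sTG abT oT n_gt1 oG co_nm /cd_latticeP[_ m1].
rewrite cd_badE sTG; apply/negP=> /cd_latticeP[_]; rewrite -m1 /cd_measure.
rewrite oT cards1 mul1n /= cent1T setIT oG => /eqP.
rewrite eqn_pmul2l ?(ltn_trans _ n_gt1) // => /eqP oC.
have : n %| m by rewrite -oC -oT cardSg // subsetI sTG.
by move=> n_dvd; move: co_nm; rewrite /coprime (gcdn_idPl n_dvd) gtn_eqF.
Qed.

(** Equating [m(T)] and [m(G)] gives [#|'C_G(T)| = m * #|'C_G(G)|]. As [n] divides this and is
    coprime to [m], it divides the order of the centre, so ['C_G(T)] has at least [n * m]
    elements. *)
Lemma abelian_Hall_central T (n m : nat) :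
    T \subset G -> abelian T -> #|T| = n ->
    #|G| = (n * m)%N -> coprime n m ->
  T \in cd_lattice G -> G \in cd_lattice G -> G \subset 'C(T).
Proof.
move=> sTG abT oT oG co_nm /cd_latticeP[_ mT] /cd_latticeP[_ mG].
have n_gt0 : 0 < n by rewrite -oT.
have oC : #|'C_G(T)| = (m * #|'C_G(G)|)%N.
  apply/eqP; rewrite -(eqn_pmul2l n_gt0) mulnA -oG -[X in (X * _)%N]oT.
  by apply/eqP; rewrite [LHS]mT -mG.
have : n %| #|'C_G(T)| by rewrite -oT cardSg // subsetI sTG.
rewrite oC Gauss_dvdr // => /dvdn_leq -/(_ (cardG_gt0 'C_G(G)%G)) le_n.
apply/setIidPl/eqP; rewrite eqEcard subsetIl oC oG mulnC leq_mul2l.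
by rewrite le_n orbT.
Qed.

(** Conjugation permutes the two nontrivial elements of [T], so ['C_G(T)] has index at most 2 and
    [m(T) = 3 * #|'C_G(T)|] exceeds [m(1) = #|G|]. *)
Lemma normal3_trivg_notin_cd_lattice T :
  T <| G -> #|T| = 3 -> 1%G \notin cd_lattice G.
Proof.
move=> /andP[sTG nTG] oT; apply/negP=> /cd_latticeP[_ m1].
have /prime_cyclic/cyclicP[x defT] : prime #|T| by rewrite oT.
have Tx : x \in T by rewrite defT cycle_id.
have nt_x : x != 1.
  by apply: contra_eqN oT => /eqP x1; rewrite defT x1 cycle1 cards1.
have le2 : #|G : 'C_G(T)| <= 2.
  rewrite defT cent_cycle index_cent1.
  have <- : #|T^#| = 2 by move: (cardsD1 1 T); rewrite group1 oT => -[].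
  apply/subset_leq_card/subsetP=> _ /imsetP[g Gg ->].
  by rewrite !inE conjg_eq1 nt_x memJ_norm // (subsetP nTG).
move: (cd_measure_le_max sTG); rewrite -m1 /cd_measure oT cards1 mul1n.
rewrite /= cent1T setIT -(Lagrange (subsetIl G 'C(T))) mulnC leq_pmul2l //.
by rewrite leqNgt ltnS le2.
Qed.

End ChermakDelgado.

(** The number of Sylow subgroups is 2, 3 or 4, and [p] divides its predecessor. *)
Lemma card_Syl_small (gT : finGroupType) (G P : {group gT}) p :
    prime p -> p.-Sylow(G) P -> ~~ (P <| G) -> #|'Syl_p(G)| < 5 ->
  (p = 2 /\ #|'Syl_p(G)| = 3) \/ (p = 3 /\ #|'Syl_p(G)| = 4).
Proof.
move=> p_pr sylP nnP.
have : #|'Syl_p(G)| != 1%N.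
  apply: contra nnP => /normal_sylowP[Q sylQ].
  exact: Sylow_normal_conj sylQ sylP.
have p_gt1 := prime_gt1 p_pr.
move: (card_Syl_mod G p_pr); case: #|'Syl_p(G)| => [|[|[|[|[|]]]]] //.
- by rewrite mod0n.
- by case: p p_gt1 {p_pr sylP} => [|[|[|p]]] //.
- by case: p p_gt1 {p_pr sylP} => [|[|[|[|p]]]] //; left.
- by case: p p_gt1 {sylP} p_pr => [|[|[|[|[|p]]]]] //; right.
Qed.

Theorem theorem1 (gT : finGroupType) (G : {group gT}) :
  cd_delta G < 5 -> nilpotent G.
Proof.
rewrite /cd_delta -/(cd_bad G) => lt_bad.
apply: Sylow_normal_nilpotent => p P p_pr sylP.
apply/idPn=> nnP; have badP := Syl_sub_cd_bad sylP nnP.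
have pP := pHall_pgroup sylP.
have Sp := card_Syl_small p_pr sylP nnP
  (leq_ltn_trans (subset_leq_card badP) lt_bad).
have n_ge3 : 3 <= #|'Syl_p(G)| by case: Sp => -[_ ->].
(* Otherwise at least [3 * 2] subgroups are outside the lattice. *)
have nP : 'N_G(P) = P.
  apply/eqP/idPn=> neqN; have := card_cd_bad_norm sylP nnP neqN.
  by rewrite leqNgt (leq_trans lt_bad) // (leq_trans _ (leq_mul n_ge3 (leqnn 2))).
have oG : #|G| = (#|'Syl_p(G)| * #|P|)%N.
  by rewrite (card_Syl sylP) nP mulnC Lagrange // (pHall_sub sylP).
have ntP : P :!=: 1 by apply: contraNneq nnP => ->; apply: normal1.
have notSyl (R : {group gT}) : coprime #|R| #|P| -> R \notin 'Syl_p(G).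
  move=> co_RP; apply: contra ntP; rewrite inE => sylR.
  move: co_RP; rewrite (card_Hall sylR) -(card_Hall sylP) /coprime gcdnn.
  by rewrite trivg_card1.
have oT (q : nat) (T : {group gT}) : p != q -> q.-nat #|'Syl_p(G)| ->
    q.-Sylow(G) T -> #|T| = #|'Syl_p(G)|.
  move=> p'q qn sylT; rewrite (card_Hall sylT) oG partnM ?cardG_gt0 //; last first.
    exact: ltn_trans n_ge3.
  by rewrite part_pnat_id // part_p'nat ?muln1 // (pi_pnat pP).
(* Besides the Sylow [p]-subgroups, there is room outside the lattice for one more subgroup when
   their number is 3, and for none when it is 4. *)
have extra (s : seq {group gT}) : uniq s -> {subset s <= cd_bad G} ->
    {in s, forall R, R \notin 'Syl_p(G)} -> #|'Syl_p(G)| + size s < 5.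
  move=> Us bad_s notSyl_s; apply: leq_ltn_trans lt_bad.
  rewrite -(cardsID 'Syl_p(G) (cd_bad G)) (setIidPr badP) leq_add2l.
  rewrite -(card_uniqP Us); apply/subset_leq_card/subsetP=> R sR.
  by rewrite inE notSyl_s ?bad_s.
have neqT (T : {group gT}) : 1 < #|T| -> 1%G != T.
  by apply: contraTneq => <-; rewrite cards1.
case: Sp => -[p_eq n_eq].
  have [T sylT] := Sylow_exists 3 G.
  have oT3 : #|T| = 3 by rewrite (oT 3) ?n_eq // p_eq.
  have co3 : coprime 3 #|P| by rewrite coprime_sym (pnat_coprime pP) // p_eq.
  have SylT R : R \in 'Syl_3(G) -> R \notin 'Syl_p(G).
    rewrite inE => sylR; apply: notSyl.
    by rewrite (card_Hall sylR) -(card_Hall sylT) oT3.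
  (* A non-normal [T] would add at least three Sylow 3-subgroups to the three Sylow 2-subgroups
     already outside. *)
  have nsT : T <| G.
    apply/idPn=> nnT; have badT := Syl_sub_cd_bad sylT nnT.
    have ST := card_Syl_small (isT : prime 3) sylT nnT
      (leq_ltn_trans (subset_leq_card badT) lt_bad).
    have : #|'Syl_p(G)| + #|'Syl_3(G)| < 5.
      rewrite [#|'Syl_3(G)|]cardE; apply: extra (enum_uniq _) _ _ => R.
        by rewrite mem_enum => /(subsetP badT).
      by rewrite mem_enum; apply: SylT.
    by rewrite n_eq; case: ST => -[_ ->].
  have bad1 : 1%G \in cd_bad G.
    by rewrite cd_badE sub1G (normal3_trivg_notin_cd_lattice nsT).
  have notSyl1 : 1%G \notin 'Syl_p(G) by apply: notSyl; rewrite cards1 coprime1n.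
  (* The trivial subgroup takes the only remaining place outside the lattice. *)
  have cd_G3 (R : {group gT}) : R \subset G -> 1 < #|R| ->
      R \notin 'Syl_p(G) -> R \in cd_lattice G.
    move=> sRG R_gt1 notSylR; apply/idPn=> CD'R.
    suff : #|'Syl_p(G)| + size [:: 1%G; R] < 5 by rewrite n_eq.
    apply: extra => [|_ /[!mem_seq2] /pred2P[]->
                     |_ /[!mem_seq2] /pred2P[]->] //.
      by rewrite /= inE neqT.
    by rewrite cd_badE sRG.
  have sGC : G \subset 'C(T).
    have G_gt1 : 1 < #|G|.
      by rewrite oG n_eq (leq_trans _ (leq_pmulr _ (cardG_gt0 P))).
    have notSylG : G \notin 'Syl_p(G).
      apply: contra nnP; rewrite inE => sylG.
      exact: Sylow_normal_conj sylG sylP (normal_refl G).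
    have abT : abelian T.
      by apply/cyclic_abelian/prime_cyclic; rewrite oT3.
    apply: (abelian_Hall_central (n := 3) (m := #|P|)) => //.
    - exact: pHall_sub sylT.
    - by rewrite oG n_eq.
    - by rewrite cd_G3 ?(pHall_sub sylT) ?oT3 // SylT // inE.
    - exact: cd_G3.
  (* Being central, [T] normalises the self-normalising [P], against the coprimality of 3 and
     [#|P|]. *)
  have sTP : T \subset P.
    rewrite -nP subsetI (pHall_sub sylT) cents_norm // centsC.
    exact: subset_trans (pHall_sub sylP) sGC.
  by have := coprime_dvdr (cardSg sTP) co3; rewrite oT3.
have [T sylT] := Sylow_exists 2 G.
have oT4 : #|T| = 4 by rewrite (oT 2) ?n_eq // p_eq.
have co4 : coprime 4 #|P| by rewrite coprime_sym (pnat_coprime pP) // p_eq.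
have abT : abelian T by apply: (card_p2group_abelian (p := 2)); rewrite ?oT4.
have notSylT : T \notin 'Syl_p(G) by apply: notSyl; rewrite oT4.
have notSyl1 : 1%G \notin 'Syl_p(G) by apply: notSyl; rewrite cards1 coprime1n.
(* The four Sylow 3-subgroups are all that is outside, so both [1] and [T] are in the lattice. *)
have good (R : {group gT}) : R \notin 'Syl_p(G) -> R \notin cd_bad G.
  move=> notSylR; apply/negP=> badR.
  suff : #|'Syl_p(G)| + size [:: R] < 5 by rewrite n_eq.
  by apply: extra => // Q; rewrite mem_seq1 => /eqP->.
have := good _ notSyl1; rewrite cd_badE sub1G negbK => CD1.
apply: (negP (good _ notSylT)).
apply: (abelian_Hall_cd_bad (n := 4) (m := #|P|)) => //.
  exact: pHall_sub sylT.
by rewrite oG n_eq.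
Qed.
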